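(* Every $3$-anti-circulant digraph is $\alpha$-diperfect.
   Context: All digraphs are finite, without loops and without multiple arcs (digons allowed). $u\to v$ means $uv$ is an arc. A path is a sequence of distinct vertices $v_1\dots v_k$ with $v_iv_{i+1}$ an arc for all $i$. A stable set is a set of pairwise non-adjacent vertices. A path partition of $D$ is a collection of vertex-disjoint paths covering $V(D)$. For a stable set $S$, an $S$-path partition is a path partition in which every path contains exactly one vertex of $S$. $D$ satisfies the $\alpha$-property if for every maximum stable set $S$ of $D$ there is an $S$-path partition; $D$ is $\alpha$-diperfect if every induced subdigraph of $D$ satisfies the $\alpha$-property. An anti-$P_4$ is a set of four distinct vertices $v_1,v_2,v_3,v_4$ with $v_1\to v_2$, $v_3\to v_2$, $v_3\to v_4$. $D$ is $3$-anti-circulant if for every anti-$P_4$ $v_1\to v_2\leftarrow v_3\to v_4$ in $D$ we have $v_4\to v_1$. *)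

(* Defs.v *)
From mathcomp Require Import all_boot.

Set Implicit Arguments.
Unset Strict Implicit.
Unset Printing Implicit Defensive.

(* A finite digraph is given by its arc relation D : rel T on a finite vertex
   type T; a relation has no multiple arcs and allows digons. Looplessness is
   the separate hypothesis [irreflexive D]. *)

Section Digraph.

Variables (T : finType) (D : rel T).

Definition stable (S : {set T}) : Prop := {in S &, forall x y, ~~ D x y}.

Definition maximum_stable (S : {set T}) : Prop :=
  stable S /\ forall S' : {set T}, stable S' -> #|S'| <= #|S|.

(* The sequence of vertices of a path; paths have at least one vertex. *)
Definition dipath (p : seq T) : bool :=
  if p is x :: q then path D x q && uniq p else false.

(* Uniqueness of [flatten P] says that the paths are pairwise disjoint. *)
Definition path_partition (P : seq (seq T)) : Prop :=
  [/\ {in P, forall p, dipath p},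
      uniq (flatten P)
    & forall x : T, x \in flatten P].

Definition S_path_partition (S : {set T}) (P : seq (seq T)) : Prop :=
  path_partition P /\ {in P, forall p, #|[set x in p] :&: S| = 1}.

Definition alpha_property : Prop :=
  forall S : {set T}, maximum_stable S -> exists P, S_path_partition S P.

Definition anti_P4 (v1 v2 v3 v4 : T) : Prop :=
  [/\ uniq [:: v1; v2; v3; v4], D v1 v2, D v3 v2 & D v3 v4].

Definition three_anti_circulant : Prop :=
  forall v1 v2 v3 v4 : T, anti_P4 v1 v2 v3 v4 -> D v4 v1.

Definition induced (X : {set T}) : rel {x : T | x \in X} :=
  fun x y => D (val x) (val y).

End Digraph.

Definition alpha_diperfect (T : finType) (D : rel T) : Prop :=
  forall X : {set T}, alpha_property (@induced T D X).

(* Main.v *)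
Require Import Defs.
From mathcomp Require Import all_boot.

(* Induct on the vertex set V, with S a maximum stable set of D[V].  If
   Y <= V \ S is nonempty, S is still maximum in V \ Y, so V \ Y has an S-path
   partition, and it suffices to insert Y into one of its paths; for instance,
   if all out-neighbours of v lie in Y and v :: Y can be ordered into a path
   from v, then v ends its path in V \ Y and Y can be appended to it.

   - By 3-anti-circularity an out-neighbourhood N+(s) is semicomplete or stable;
     in the first case, for s in S, append a Hamiltonian path of N+(s) to s.
   - Let s in S, s -> x <- z with z notin S and N+(s) stable.  Then every
     w <> x in N+(s) dominates z.  If N+(s) = {x, w}, append w z x to s.
     Otherwise partition V \ {x, z} and pick w in N+(s) - x whose successor g
     there is not s: a second w' in N+(s) - x gives g -> w' and then x -> g, so
     that w g can be replaced with w z x g.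
   - Hence a vertex outside S with an in-neighbour (resp. out-neighbour) in S has
     all its in-neighbours (resp. out-neighbours) in S.  For an arc b -> c inside
     V \ S this leaves no in-neighbour of c and no out-neighbour of b in S; both
     can be assumed to have another neighbour b' -> c and b -> c', and then
     c' -> b' contradicts that c' has an out-neighbour in S.
   - So V \ S is stable.  Take an edge sz with s in S.  If S - s is maximum in
     V - {s, z}, remove the path on {s, z}; otherwise another maximum stable set
     S' avoids s and z, and V splits into the symmetric difference of S and S'
     and its complement, in both of which S is maximum. *)

Set Implicit Arguments.
Unset Strict Implicit.
Unset Printing Implicit Defensive.

(** * Path partitions meeting [S] once per path, and insertion into them *)

Section OrthogonalPartitions.

Variables (T : finType) (D : rel T).
Implicit Types (V S : {set T}) (P : seq (seq T)).

(** Taking [V] as a subset of a fixed type avoids nested subtypes in the induction. The count also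
    forces paths to be nonempty. *)
Definition orthogonal_partition V S P : Prop :=
  [/\ all (sorted D) P, perm_eq (flatten P) (enum V)
    & all (fun p => count [in S] p == 1) P].

Definition partitionable V S : Prop := exists P, orthogonal_partition V S P.

Lemma semicomplete_path (s : T) (l : seq T) :
  {in l, forall x, D s x} ->
  {in l &, forall x y, x != y -> D x y || D y x} -> uniq l ->
  exists2 q, perm_eq q l & path D s q.
Proof.
elim: l => [|x l IHl] sl semil; first by exists [::].
case/andP=> xNl uniql.
have [||q ql sq] := IHl _ _ uniql.
- by move=> z zl; apply: sl; rewrite inE zl orbT.
- by move=> z z' zl z'l; apply: semil; rewrite inE ?zl ?z'l orbT.
have sx : D s x by apply: sl; rewrite mem_head.
have semix : {in q, forall z, D x z || D z x}.
  move=> z; rewrite (perm_mem ql) => zl; apply: semil; rewrite ?mem_head //.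
    by rewrite inE zl orbT.
  by apply: contraNneq xNl => ->.
suff [q' q'q sq'] : exists2 q', perm_eq q' (x :: q) & path D s q'.
  by exists q' => //; apply: perm_trans q'q _; rewrite perm_cons.
(* [x] goes just before the first vertex of [q] that it dominates; each vertex passed over dominates
   [x] and takes the role of [s]. *)
elim: q s {sl IHl ql} sq sx semix => [|h q IHq] s /=.
  by move=> _ sx _; exists [:: x] => //=; rewrite sx.
case/andP=> sh hq sx semix.
case: (boolP (D x h)) => [xh|/negbTE xNh].
  by exists [:: x, h & q]; rewrite //= sx xh.
have hx : D h x by have := semix h (mem_head _ _); rewrite xNh.
have [z zq|q' q'q hq'] := IHq h hq hx; first by apply: semix; rewrite inE zq orbT.
exists (h :: q'); last by rewrite /= sh.
apply: (@perm_trans _ (h :: x :: q)); first by rewrite perm_cons.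
by rewrite (perm_catCA [:: h] [:: x] q).
Qed.

Lemma orthogonal_partition_insert V S P (p1 p2 y : seq T) :
  orthogonal_partition (V :\: [set x in y]) S P -> p1 ++ p2 \in P ->
  uniq y -> {subset y <= V :\: S} -> sorted D (p1 ++ y ++ p2) ->
  partitionable V S.
Proof.
case=> sortP flatP oneP pP uniqy yVS sorty; have permP := perm_to_rem pP.
move: sortP oneP; rewrite !(perm_all _ permP) => /andP[_ sortP] /andP[onep oneP].
exists ((p1 ++ y ++ p2) :: rem (p1 ++ p2) P); split.
- by rewrite /= sorty.
- have /perm_flatten := permP; rewrite perm_sym => /perm_trans/(_ flatP) flatP'.
  have: perm_eq (y ++ flatten ((p1 ++ p2) :: rem (p1 ++ p2) P))
                (y ++ enum (V :\: [set x in y])) by rewrite perm_cat2l.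
  rewrite /= -!catA perm_catCA => /perm_trans; apply.
  apply: uniq_perm; last 1 first.
  - move=> x; rewrite mem_cat !mem_enum !inE.
    by case: (boolP (x \in y)) => //= /yVS; rewrite inE => /andP[_ ->].
  - rewrite cat_uniq uniqy enum_uniq andbT /=.
    by apply/hasPn => x; rewrite mem_enum !inE => /andP[].
  - exact: enum_uniq.
- apply/andP; split; last exact: oneP.
  rewrite !count_cat [count _ y](eq_in_count (a2 := pred0)).
    by rewrite count_pred0 -count_cat.
  by move=> x /yVS; rewrite !inE => /andP[/negbTE].
Qed.

Lemma partitionable_append V S v (y : seq T) :
  v \in V -> v \notin y -> uniq y -> {subset y <= V :\: S} -> path D v y ->
  {in V, forall g, D v g -> g \in y} ->
  partitionable (V :\: [set x in y]) S -> partitionable V S.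
Proof.
move=> vV vNy uniqy yVS vy vsucc [P partP].
have [sortP flatP _] := partP.
have: v \in flatten P by rewrite (perm_mem flatP) mem_enum !inE vNy.
case/flattenP=> p pP /splitPr vp; case: vp pP => p1 [|g p2] pP.
  apply: (@orthogonal_partition_insert V S P (rcons p1 v) [::] y) => //.
    by rewrite cats0 -cats1.
  rewrite cats0 cat_rcons sorted_cat_cons vy andbT.
  by have := allP sortP _ pP; rewrite cats1.
have := allP sortP _ pP; rewrite sorted_cat_cons /= => /and3P[_ vg _].
have: g \in enum (V :\: [set x in y]).
  rewrite -(perm_mem flatP); apply/flattenP; exists (p1 ++ v :: g :: p2) => //.
  by rewrite mem_cat !inE eqxx !orbT.
by rewrite mem_enum !inE => /andP[/negP gNy gV]; case: gNy; apply: vsucc.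
Qed.

(** Both paths contain [s], so they coincide, and the predecessor of [s] is read off at the position
    before its index. *)
Lemma pred_uniq P (p1 p2 q1 q2 : seq T) (a b s : T) :
  uniq (flatten P) -> p1 ++ [:: a, s & p2] \in P -> q1 ++ [:: b, s & q2] \in P ->
  a = b.
Proof.
move=> uniqP pP qP.
set p := p1 ++ _ in pP; set q := q1 ++ _ in qP.
have sp : s \in p by rewrite mem_cat !inE eqxx !orbT.
have sq : s \in q by rewrite mem_cat !inE eqxx !orbT.
have permP := perm_to_rem pP.
have := perm_uniq (perm_flatten permP); rewrite uniqP /= cat_uniq.
case/esym/and3P=> uniqp /hasPn disj _.
have eqpq : p = q.
  move: qP; rewrite (perm_mem permP) inE => /orP[/eqP-> //|qP].
  have: s \in flatten (rem p P) by apply/flattenP; exists q.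
  by move/disj; rewrite /= sp.
have idx (r1 r2 : seq T) c : uniq (r1 ++ [:: c, s & r2]) ->
    nth s (r1 ++ [:: c, s & r2]) (index s (r1 ++ [:: c, s & r2])).-1 = c.
  rewrite cat_uniq => /and3P[_ /hasPn sNr /= /andP[cNs _]].
  have /negbTE sNr1 : s \notin r1 by apply: sNr; rewrite !inE eqxx orbT.
  rewrite index_cat sNr1 /= eqxx; case: eqP => [E|_].
    by move: cNs; rewrite E mem_head.
  by rewrite addn1 /= nth_cat ltnn subnn.
have := idx p1 p2 a uniqp; rewrite -/p {1 2}eqpq (idx q1 q2 b) //.
by rewrite -/q -eqpq.
Qed.

End OrthogonalPartitions.

(** * Reversal of all arcs *)

Section Reversal.

Variables (T : finType) (D : rel T).
Implicit Types (V S : {set T}).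

Lemma three_anti_circulant_rev :
  three_anti_circulant D -> three_anti_circulant (fun x y => D y x).
Proof.
move=> acD v1 v2 v3 v4 [uniqv D12 D32 D34]; apply: (acD v4 v3 v2 v1); split=> //.
by move: uniqv; rewrite -rev_uniq.
Qed.

Lemma partitionable_rev V S :
  partitionable (fun x y => D y x) V S -> partitionable D V S.
Proof.
case=> P [sortP flatP oneP]; exists (map rev P); split.
- by rewrite all_map; apply: sub_all sortP => p /=; rewrite rev_sorted.
- apply: perm_trans flatP; elim: P {sortP oneP} => //= p P IHP.
  by apply: perm_cat => //; rewrite perm_rev.
- by rewrite all_map; apply: sub_all oneP => p /=; rewrite count_rev.
Qed.

End Reversal.

(** * Neighbourhoods of the vertices of [S] *)

Section AntiCirculant.

Variables (T : finType) (D : rel T).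
Hypotheses (loopless : irreflexive D) (acD : three_anti_circulant D).
Implicit Types (V S : {set T}).

(** By [step], once [x] misses one out-neighbour [y] of [s], it misses every [w]: [x -> w <- s -> y]
    gives [y -> x], while [w -> x <- s -> y] gives [y -> w], and then [y -> w <- s -> x] gives
    [x -> y]. *)
Lemma out_neighbours_stable V s a b :
  D s a -> D s b -> a != b -> ~~ D a b -> ~~ D b a ->
  stable D [set w in V | D s w].
Proof.
have step x y w : D s x -> D s y -> D s w -> x != y -> ~~ D x y -> ~~ D y x ->
    ~~ D w x && ~~ D x w.
  move=> sx sy sw xy Nxy Nyx.
  have neqs u v : D s u -> D s v -> D u v -> (u != v) * (u != s) * (v != s).
    move=> su sv uv; do !split.
    - by apply: contraTneq uv => ->; rewrite loopless.
    - by apply: contraTneq su => ->; rewrite loopless.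
    - by apply: contraTneq sv => ->; rewrite loopless.
  have NxwE : ~~ D x w.
    apply: contra Nyx => xw; apply: (@acD x w s y); split=> //=.
    have [[xNw xNs] wNs] := neqs _ _ sx sw xw.
    have yNs : y != s by apply: contraTneq sy => ->; rewrite loopless.
    have yNw : y != w by apply: contraNneq Nxy => ->.
    by rewrite !inE !negb_or xNw xNs xy wNs (eq_sym w) yNw eq_sym yNs.
  rewrite NxwE andbT; apply/negP => wx.
  have [[wNx wNs] xNs] := neqs _ _ sw sx wx.
  have yNs : y != s by apply: contraTneq sy => ->; rewrite loopless.
  have wNy : w != y by apply: contraNneq Nyx => <-.
  have yw : D y w.
    apply: (@acD w x s y); split=> //=.
    by rewrite !inE !negb_or wNx wNs wNy xNs xy (eq_sym s) yNs.
  case/negP: Nxy; apply: (@acD y w s x); split=> //=.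
  by rewrite !inE !negb_or (eq_sym y) wNy yNs (eq_sym y) xy wNs wNx (eq_sym s) xNs.
move=> sa sb ab Nab Nba c d; rewrite !inE => /andP[_ sc] /andP[_ sd].
have [->|cNa] := eqVneq c a; first by have /andP[] := step a b d sa sb sd ab Nab Nba.
have /andP[Nca Nac] := step a b c sa sb sc ab Nab Nba.
by have /andP[] := step c a d sc sa sd cNa Nca Nac.
Qed.

(** The second hypothesis abstracts the induction hypothesis, so that the lemma also applies to the
    reversed digraph. *)
Lemma partitionable_in_neighbours V S s x z :
  stable D S ->
  (forall y : seq T, y != [::] -> {subset y <= V :\: S} ->
    partitionable D (V :\: [set w in y]) S) ->
  s \in S -> s \in V -> x \in V -> z \in V -> D s x -> D z x -> z \notin S ->
  partitionable D V S.
Proof.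
move=> stS IH sS sV xV zV sx zx zNS.
pose X := [set w in V | D s w].
have xX : x \in X by rewrite inE xV.
have outNS w : D s w -> w \notin S.
  by move=> sw; apply: contraL sw => wS; apply: stS.
have sNout w : D s w -> w != s by apply: contraTneq => ->; rewrite loopless.
have XVS w : w \in X -> w \in V :\: S.
  by rewrite !inE => /andP[-> /outNS->].
have zVS : z \in V :\: S by rewrite inE zNS.
have xVS := XVS _ xX.
have sNz : s != z by apply: contraNneq zNS => <-.
have xNs := sNout _ sx.
have zNx : z != x by apply: contraTneq zx => ->; rewrite loopless.
have [semi|] := boolP [forall a in X, forall b in X,
    (a != b) ==> (D a b || D b a)].
  have [|||q qX sq] := @semicomplete_path _ D s (enum X).
  - by move=> w; rewrite mem_enum inE => /andP[].
  - move=> a b; rewrite !mem_enum => aX bX /(implyP _); apply.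
    exact: (forall_inP (forall_inP semi a aX) b bX).
  - exact: enum_uniq.
  have qE w : (w \in q) = (w \in X) by rewrite (perm_mem qX) mem_enum.
  have qVS : {subset q <= V :\: S} by move=> w; rewrite qE => /XVS.
  apply: (@partitionable_append _ D V S s q) => //.
  - by rewrite qE inE sV loopless.
  - by rewrite (perm_uniq qX) enum_uniq.
  - by move=> g gV sg; rewrite qE inE gV.
  - by apply: IH => //; apply: contraTneq xX => q0; rewrite -qE q0.
case/forall_inPn => a aX /forall_inPn[b bX]; rewrite negb_imply negb_or.
case/and3P=> ab Nab Nba.
have [sa sb] : D s a /\ D s b by move: aX bX; rewrite !inE => /andP[_ ->] /andP[].
have stX : stable D X := out_neighbours_stable sa sb ab Nab Nba.
have zNX : z \notin X by apply: contraL zx => zX; apply: stX.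
have sX w : w \in X -> D s w by rewrite inE => /andP[].
(* From [z -> x <- s -> w]. *)
have wz w : w \in X -> w != x -> D w z.
  move=> wX wNx; have sw := sX _ wX; apply: (@acD z x s w); split=> //=.
  have zNw : z != w by apply: contraNneq zNX => ->.
  by rewrite !inE !negb_or zNx (eq_sym z) sNz zNw xNs (eq_sym x) wNx
             (eq_sym s) sNout.
have [w wX wNx] : exists2 w, w \in X & w != x.
  have [ax|aNx] := eqVneq a x; last by exists a.
  by exists b => //; rewrite eq_sym -ax.
have [[w' w'X /andP[w'Nx w'Nw]]|Xwx] :
    (exists2 w', w' \in X & (w' != x) && (w' != w)) \/ {subset X <= [:: w; x]}.
  have [/exists_inP[w' w'X w'xw]|/exists_inPn Xwx] :=
    boolP [exists w' in X, (w' != x) && (w' != w)]; [left|right].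
    by exists w'.
  by move=> u /Xwx; rewrite !inE negb_and !negbK orbC.
- have [|| P partP] := IH [:: z; x] => //.
    by move=> u; rewrite !inE => /orP[]/eqP->; rewrite -in_setD.
  have [sortP flatP _] := partP.
  have uniqP : uniq (flatten P) by rewrite (perm_uniq flatP) enum_uniq.
  have flatE u : (u \in flatten P) = (u \in V) && (u != z) && (u != x).
    by rewrite (perm_mem flatP) mem_enum !inE negb_or andbC andbA.
  (* [z], [x] are inserted right after [u]. If [u] has a successor [g], then [u' -> z <- u -> g]
     gives [g -> u'], and [g -> u' <- s -> x] gives [x -> g]; the latter needs [g != s]. *)
  have finish u u' : u \in X -> u != x -> u' \in X -> u' != x -> u != u' ->
      (forall p1 p2, p1 ++ [:: u, s & p2] \notin P) -> partitionable D V S.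
    move=> uX uNx u'X u'Nx uNu' uNpred.
    have uNz : u != z by apply: contraNneq zNX => <-.
    have u'Nz : u' != z by apply: contraNneq zNX => <-.
    have: u \in flatten P.
      by rewrite flatE uNz uNx !andbT; move: uX; rewrite inE => /andP[].
    case/flattenP=> p pP /splitPr up; case: up pP => p1 p2 pP.
    have sortp := allP sortP _ pP.
    apply: (@orthogonal_partition_insert _ D V S P (rcons p1 u) p2 [:: z; x]) => //.
    + by rewrite cat_rcons.
    + by rewrite /= inE zNx.
    + by move=> v; rewrite !inE => /orP[]/eqP->; rewrite -in_setD.
    rewrite cat_rcons sorted_cat_cons /= wz // zx.
    move: sortp; rewrite sorted_cat_cons => /andP[-> /=].
    case: p2 pP => [|g p2] //= pP /andP[ug ->]; rewrite andbT.
    have gNs : g != s by apply: contraTneq pP => ->; apply: uNpred.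
    have: g \in flatten P.
      by apply/flattenP; exists (p1 ++ [:: u, g & p2]);
         rewrite // mem_cat !inE eqxx !orbT.
    rewrite flatE => /andP[/andP[gV gNz] gNx].
    have gNX : g \notin X by apply: contraL ug => gX; apply: stX.
    have gNu : g != u by apply: contraNneq gNX => ->.
    have gNu' : g != u' by apply: contraNneq gNX => ->.
    have gu' : D g u'.
      apply: (@acD u' z u g); split; rewrite ?wz //=.
      by rewrite !inE !negb_or u'Nz (eq_sym u') uNu' (eq_sym u') gNu'
                 (eq_sym z) uNz (eq_sym z) gNz (eq_sym u) gNu.
    apply: (@acD g u' s x); split; rewrite ?sX //=.
    by rewrite !inE !negb_or gNu' gNs gNx (sNout _ (sX _ u'X)) u'Nx (eq_sym s) xNs.
  (* At most one vertex precedes [s] in [P], so [w] or [w'] can serve as [u]. *)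
  have [|/hasPn Nws] := boolP (has (infix [:: w; s]) P).
    case/hasP=> p pP /infixP[p1 [p2 pE]].
    apply: (finish w' w) => // q1 q2; apply: contra w'Nw => qP.
    by rewrite pE in pP; apply/eqP; apply: pred_uniq uniqP qP pP.
  apply: (finish w w') => // [|p1 p2]; first by rewrite eq_sym.
  by apply/negP => /Nws/infixP; case; exists p1, p2.
- have wVS := XVS _ wX; have sw := sX _ wX.
  have wNz : w != z by apply: contraNneq zNX => <-.
  have yVS : {subset [:: w; z; x] <= V :\: S}.
    by move=> u; rewrite !inE => /or3P[]/eqP->; rewrite -in_setD.
  apply: (@partitionable_append _ D V S s [:: w; z; x]) => //.
  + by rewrite !inE !negb_or (eq_sym s) sNout // sNz eq_sym.
  + by rewrite /= !inE !negb_or wNz wNx zNx.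
  + by rewrite /= sw wz // zx.
  + move=> g gV sg; have: g \in X by rewrite inE gV.
    by move/Xwx; rewrite !inE => /orP[]->; rewrite ?orbT.
  + exact: IH.
Qed.

End AntiCirculant.

(** * The induction on the vertex set *)

Section Main.

Variables (T : finType) (D : rel T).
Implicit Types (V S A : {set T}).

Lemma stableP S :
  reflect (stable D S) [forall x in S, forall y in S, ~~ D x y].
Proof.
apply: (iffP forall_inP) => [stS x y xS yS|stS x xS].
  exact: (forall_inP (stS x xS)).
by apply/forall_inP => y yS; apply: stS.
Qed.

Lemma stableU A S :
  stable D A -> stable D S ->
  {in A & S, forall x y, ~~ D x y && ~~ D y x} -> stable D (A :|: S).
Proof.
move=> stA stS AS x y; rewrite !inE => /orP[xA|xS] /orP[yA|yS].
- exact: stA.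
- by case/andP: (AS x y xA yS).
- by case/andP: (AS y x yA xS).
- exact: stS.
Qed.

(** The traces of [S] appear because the induction requires a subset of each part; on paths inside a
    part, [S] and its trace have the same count. *)
Lemma partitionable_cat V S A :
  partitionable D (V :&: A) (S :&: (V :&: A)) ->
  partitionable D (V :\: A) (S :&: (V :\: A)) -> partitionable D V S.
Proof.
have weaken B : partitionable D B (S :&: B) -> partitionable D B S.
  case=> P [sortP flatP oneP]; exists P; split=> //.
  apply/allP => p pP; rewrite -(eqP (allP oneP p pP)); apply/eqP.
  apply: eq_in_count => x xp /=; rewrite inE.
  have: x \in enum B by rewrite -(perm_mem flatP); apply/flattenP; exists p.
  by rewrite mem_enum => ->; rewrite andbT.
move=> /weaken[P1 [sort1 flat1 one1]] /weaken[P2 [sort2 flat2 one2]].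
exists (P1 ++ P2); split; rewrite ?all_cat ?sort1 ?one1 // flatten_cat.
apply: perm_trans (perm_cat flat1 flat2) _.
apply: uniq_perm; last 1 first.
- move=> x; rewrite mem_cat !mem_enum !inE.
  by case: (x \in A); rewrite ?andbF ?andbT ?orbF.
- rewrite cat_uniq !enum_uniq andbT /=; apply/hasPn => x.
  by rewrite !mem_enum !inE => /andP[/negbTE-> _]; rewrite andbF.
- exact: enum_uniq.
Qed.

Lemma partitionable_edge S s z :
  s \in S -> z \notin S -> D s z || D z s -> partitionable D [set s; z] S.
Proof.
move=> sS zNS sz; have sNz : s != z by apply: contraNneq zNS => <-.
have enumE : perm_eq [:: s; z] (enum [set s; z]).
  apply: uniq_perm; rewrite ?enum_uniq //= ?inE ?sNz // => x.
  by rewrite mem_enum !inE.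
case/orP: sz => [sz|zs].
  by exists [:: [:: s; z]]; split; rewrite //= ?sz ?sS ?(negbTE zNS).
exists [:: [:: z; s]]; split; rewrite //= ?zs ?sS ?(negbTE zNS) //.
by apply: perm_trans enumE; rewrite (perm_catC [:: z] [:: s]).
Qed.

Lemma partitionable_singletons S : partitionable D S S.
Proof.
exists [seq [:: x] | x <- enum S]; split.
- by rewrite all_map; apply/allP.
- by elim: (enum S) => //= x s IHs; rewrite perm_cons.
- by rewrite all_map; apply/allP => x; rewrite mem_enum /= => ->.
Qed.

Hypotheses (loopless : irreflexive D) (acD : three_anti_circulant D).

Lemma partitionable_of_maximum V S :
  S \subset V -> stable D S ->
  (forall S', S' \subset V -> stable D S' -> #|S'| <= #|S|) ->
  partitionable D V S.
Proof.
have [n] := ubnP #|V|; elim: n => // n IHn in V S *; rewrite ltnS => leVn SV stS maxS.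
have IH V' S' : V' \proper V -> S' \subset V' -> stable D S' ->
    (forall S'', S'' \subset V' -> stable D S'' -> #|S''| <= #|S'|) ->
    partitionable D V' S'.
  by move=> V'V; apply: IHn; apply: leq_trans leVn; apply: proper_card.
have IHdel (y : seq T) : y != [::] -> {subset y <= V :\: S} ->
    partitionable D (V :\: [set w in y]) S.
  move=> y0 yVS; apply: IH => //.
  - rewrite properE subsetDl; case: y y0 yVS => // a y _ /(_ a (mem_head _ _)).
    rewrite inE => /andP[_ aV]; apply/negP => /subsetP/(_ a aV).
    by rewrite !inE eqxx.
  - apply/subsetP => s sS; rewrite !inE (subsetP SV) // andbT.
    by apply/negP => /yVS; rewrite inE sS.
  - by move=> S' S'V; apply: maxS; apply: subset_trans S'V (subsetDl _ _).
have SinV s : s \in S -> s \in V by apply: (subsetP SV).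
have [|/exists_inPn inS] := boolP [exists s in S, exists x in V,
    exists z in V, [&& z \notin S, D s x & D z x]].
  case/exists_inP=> s sS /exists_inP[x xV /exists_inP[z zV]].
  case/and3P=> zNS sx zx.
  by apply: (partitionable_in_neighbours loopless acD stS IHdel sS) sx zx _; auto.
have {}inS s x z : s \in S -> x \in V -> z \in V -> D s x -> D z x -> z \in S.
  move=> sS xV zV sx zx; apply: contraT => zNS; case/negP: (inS s sS).
  apply/exists_inP; exists x => //; apply/exists_inP; exists z => //.
  by rewrite zNS sx.
have [|/exists_inPn outS] := boolP [exists s in S, exists x in V,
    exists z in V, [&& z \notin S, D x s & D x z]].
  case/exists_inP=> s sS /exists_inP[x xV /exists_inP[z zV]].
  case/and3P=> zNS xs xz.
  apply: partitionable_rev.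
  apply: (@partitionable_in_neighbours _ _ _ _ V S s x z) => //.
  - exact: three_anti_circulant_rev.
  - by move=> a b aS bS; apply: stS.
  - by move=> y y0 yVS; apply: partitionable_rev; apply: IHdel.
  - exact: SinV.
have {}outS s x z : s \in S -> x \in V -> z \in V -> D x s -> D x z -> z \in S.
  move=> sS xV zV xs xz; apply: contraT => zNS; case/negP: (outS s sS).
  apply/exists_inP; exists x => //; apply/exists_inP; exists z => //.
  by rewrite zNS xs.
(* Otherwise [x |: S] would be a larger stable set. *)
have nbrS x : x \in V -> x \notin S -> exists2 s, s \in S & D s x || D x s.
  move=> xV xNS; apply/exists_inP; apply: contraT => /exists_inPn Nx.
  have: stable D (x |: S).
    apply: stableU => // [u v|u s].
      by rewrite !inE => /eqP-> /eqP->; rewrite loopless.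
    by rewrite inE => /eqP-> /Nx; rewrite negb_or andbC.
  move/maxS; rewrite subUset sub1set xV SV cardsU1 xNS => /(_ isT).
  by rewrite add1n ltnn.
have [/exists_inP[b bVS /exists_inP[c cVS bc]]|/exists_inPn indepVS] :=
  boolP [exists b in V :\: S, exists c in V :\: S, D b c].
  move: (bVS) (cVS); rewrite !inE => /andP[bNS bV] /andP[cNS cV].
  have bNc : b != c by apply: contraTneq bc => ->; rewrite loopless.
  have [/exists_inP[c' c'V /andP[c'Nc bc']]|/exists_inPn bout] :=
    boolP [exists c' in V, (c' != c) && D b c']; last first.
    apply: (@partitionable_append _ D V S b [:: c]) => //=.
    - by rewrite inE.
    - by move=> u; rewrite inE => /eqP->.
    - by rewrite bc.
    - by move=> g /bout; rewrite negb_and negbK inE => /orP[//|/negP].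
    - by apply: IHdel => // u; rewrite inE => /eqP->.
  have [/exists_inP[b' b'V /andP[b'Nb b'c]]|/exists_inPn cin] :=
    boolP [exists b' in V, (b' != b) && D b' c]; last first.
    apply: partitionable_rev.
    apply: (@partitionable_append _ _ V S c [:: b]) => //=.
    - by rewrite inE eq_sym.
    - by move=> u; rewrite inE => /eqP->.
    - by rewrite bc.
    - by move=> g /cin; rewrite negb_and negbK inE => /orP[//|/negP].
    - by apply: partitionable_rev; apply: IHdel => // u; rewrite inE => /eqP->.
  have c'NS : c' \notin S.
    by apply: contra cNS => c'S; apply: outS bc' bc.
  have b'NS : b' \notin S.
    by apply: contra bNS => b'S; apply: inS b'c bc.
  (* [s -> c'] would put [b] in [S]; with [c' -> s], the arc [c' -> b'] puts [b'] in [S]. *)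
  have [s sS /orP[sc'|c's]] := nbrS c' c'V c'NS.
    by case/negP: bNS; apply: inS sc' bc'.
  case/negP: b'NS; apply: (outS s c') => //.
  apply: (@acD b' c b c'); split=> //=.
  have b'Nc : b' != c by apply: contraTneq b'c => ->; rewrite loopless.
  have bNc' : b != c' by apply: contraTneq bc' => ->; rewrite loopless.
  rewrite !inE !negb_or b'Nc b'Nb (eq_sym c) bNc (eq_sym c) c'Nc bNc' !andbT.
  (* If [b' = c'], then [c' -> s] and [c' -> c] would put [c] in [S]. *)
  by apply: contraNneq cNS => b'E; apply: outS c's _; rewrite -?b'E.
have [VS0|[z zVS]] := set_0Vmem (V :\: S).
  have -> : V = S by apply/eqP; rewrite eqEsubset SV -setD_eq0 VS0 eqxx.
  exact: partitionable_singletons.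
move: (zVS); rewrite inE => /andP[zNS zV].
have [s sS sz] := nbrS z zV zNS; have sV := SinV s sS.
pose V' := V :\: [set s; z].
have [/forall_inP maxS'|/forall_inPn[S' /andP[S'V' /stableP stS']]] :=
  boolP [forall (S' : {set T} | (S' \subset V') &&
     [forall x in S', forall y in S', ~~ D x y]), #|S'| <= #|S :\ s|].
  have eqV : V :&: [set s; z] = [set s; z].
    by apply/setIidPr; rewrite subUset !sub1set sV zV.
  have eqS : S :&: V' = S :\ s.
    apply/setP => x; rewrite !inE negb_or.
    case: (boolP (x \in S)) => [xS|]; rewrite ?andbF //= (SinV x) // !andbT.
    have [->|_] //= := eqVneq x s.
    by apply: contraNneq zNS => <-.
  apply: (@partitionable_cat V S [set s; z]).
    rewrite eqV; apply: partitionable_edge => //; first by rewrite !inE sS eqxx.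
    by rewrite inE (negbTE zNS).
  rewrite -/V' eqS; apply: IH.
  - rewrite properE subsetDl; apply/negP => /subsetP/(_ s sV).
    by rewrite !inE eqxx.
  - by rewrite -eqS subsetIr.
  - by move=> x y /setD1P[_ xS] /setD1P[_ yS]; apply: stS.
  - by move=> S' S'V' stS'; apply: maxS'; rewrite S'V'; apply/stableP.
rewrite -ltnNge => ltS'; have {ltS'} leS' : #|S| <= #|S'| by rewrite (cardsD1 s) sS.
have S'V : S' \subset V by apply: subset_trans S'V' (subsetDl _ _).
have sNS' : s \notin S' by apply/negP => /(subsetP S'V'); rewrite !inE eqxx.
have zNS' : z \notin S' by apply/negP => /(subsetP S'V'); rewrite !inE eqxx orbT.
(* [s] lies in [A] and [z] does not, so both [A] and [V :\: A] are proper subsets of [V]. *)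
pose A := (S :\: S') :|: (S' :\: S).
have eqV : V :&: A = A.
  by apply/setIidPr; rewrite subUset !(subset_trans (subsetDl _ _)).
have cardSS' : #|S :&: S'| + #|S' :\: S| = #|S|.
  by rewrite setIC cardsID; apply/eqP; rewrite eqn_leq leS' andbT maxS.
have stW (S1 S2 : {set T}) : S1 \subset S2 -> stable D S2 -> stable D S1.
  by move=> /subsetP S12 st2 x y /S12 xS /S12 yS; apply: st2.
apply: (@partitionable_cat V S A).
  have eqS : S :&: A = S :\: S'.
    by apply/setP => x; rewrite !inE; case: (x \in S); case: (x \in S').
  rewrite eqV eqS; apply: IH.
  - rewrite properE -{1}eqV subsetIl; apply/negP => /subsetP/(_ z zV).
    by rewrite !inE (negbTE zNS) (negbTE zNS').
  - exact: subsetUl.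
  - exact: stW (subsetDl _ _) stS.
  (* Since [A] lies in the union of [S] and [S'], a stable [W] in [A] stays stable after adding
     [S :&: S']; the bound by [#|S|] then gives the claim. *)
  - move=> W WA stWD; rewrite -(leq_add2l #|S :&: S'|) cardsID.
    rewrite -cardsUI (_ : #|_ :&: W| = 0) ?addn0.
      apply: maxS.
        rewrite subUset (subset_trans (subsetIl _ _)) //.
        by rewrite (subset_trans WA) // -eqV subsetIl.
      apply: stableU => // [|x y]; first exact: stW (subsetIl _ _) stS.
      rewrite inE => /andP[xS xS'] /(subsetP WA).
      rewrite !inE => /orP[]/andP[_ yS]; first by rewrite !stS.
      by rewrite !stS'.
    apply/eqP; rewrite cards_eq0 -subset0; apply/subsetP => x.
    rewrite !inE => /andP[/andP[xS xS'] /(subsetP WA)].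
    by rewrite !inE xS xS'.
have eqS : S :&: (V :\: A) = S :&: S'.
  apply/setP => x; rewrite !inE; case: (boolP (x \in S)) => //= xS.
  by rewrite SinV // andbT; case: (x \in S').
rewrite eqS; apply: IH.
- rewrite properE subsetDl; apply/negP => /subsetP/(_ s sV).
  by rewrite !inE sS sNS'.
- by rewrite -eqS subsetIr.
- exact: stW (subsetIl _ _) stS.
(* Adding [S' :\: S] to [W] keeps it stable: vertices of [W] in [S] are also in [S'], and the others
   lie with [S' :\: S] in the stable set [V :\: S]. *)
move=> W WA stWD; rewrite -(leq_add2r #|S' :\: S|) cardSS'.
rewrite -cardsUI (_ : #|W :&: _| = 0) ?addn0.
  apply: maxS.
    rewrite subUset (subset_trans WA (subsetDl _ _)).
    by rewrite (subset_trans (subsetDl _ _)).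
  apply: stableU => // [|x y]; first exact: stW (subsetDl _ _) stS'.
  move=> /(subsetP WA); rewrite !inE => /andP[]; case: (boolP (x \in S)) => /= xS.
    rewrite andbT orbF negbK => xS' _ /andP[_ yS'].
    by rewrite !stS'.
  move=> _ xV /andP[yNS yS'].
  have indep u v : u \in V -> v \in V -> u \notin S -> v \notin S -> ~~ D u v.
    move=> uV vV uNS vNS; have uVS : u \in V :\: S by rewrite inE uNS.
    by have /exists_inPn := indepVS u uVS; apply; rewrite inE vNS.
  by rewrite !indep // (subsetP S'V).
apply/eqP; rewrite cards_eq0 -subset0; apply/subsetP => x.
rewrite !inE => /andP[/(subsetP WA)]; rewrite !inE => /andP[xNA _] xS'S.
by rewrite xS'S orbT in xNA.
Qed.

End Main.

(** * From the whole vertex set to all induced subdigraphs *)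

Lemma alpha_property_three_anti_circulant (T : finType) (D : rel T) :
  irreflexive D -> three_anti_circulant D -> alpha_property D.
Proof.
move=> loopless acD S [stS maxS].
have [|P [sortP flatP oneP]] :=
  partitionable_of_maximum loopless acD (subsetT S) stS.
  by move=> S' _; apply: maxS.
have uniqP : uniq (flatten P) by rewrite (perm_uniq flatP) enum_uniq.
have uniqp p : p \in P -> uniq p.
  move=> pP; have := perm_uniq (perm_flatten (perm_to_rem pP)).
  by rewrite uniqP /= cat_uniq => /esym/andP[].
exists P; split; first split=> //.
- move=> p pP; have := allP oneP p pP; have := allP sortP p pP.
  by have := uniqp p pP; case: p {pP} => [|x q] //= -> ->.
- by move=> x; rewrite (perm_mem flatP) mem_enum inE.
move=> p pP; rewrite -(eqP (allP oneP p pP)) -size_filter.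
rewrite -(card_uniqP (filter_uniq _ (uniqp p pP))).
by apply: eq_card => x; rewrite mem_filter !inE andbC.
Qed.

Theorem theorem3 (T : finType) (D : rel T) (loopless : irreflexive D)
    (anti_circulant : three_anti_circulant D) :
  alpha_diperfect D.
Proof.
(* Both hypotheses are inherited by induced subdigraphs. *)
move=> X; apply: alpha_property_three_anti_circulant => [x|v1 v2 v3 v4].
  exact: loopless.
case=> uniqv D12 D32 D34; apply: (anti_circulant _ (val v2) (val v3)); split=> //.
Qed.
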